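(* Let $p$ be a prime, let $a_1,a_2$ be positive integers, and let $r,b$ be integers with $1\leq r\leq b-1$ and $b\geq 2$. Let $G$ be the group generated by $\beta_1,\beta_2,\alpha_1,\alpha_2$ subject to the relations $$[\beta_1,\alpha_1]=\beta_1^{p^r},\quad [\beta_2,\alpha_2]=\beta_2^{p^r},\quad \alpha_1^{p^{a_1}}=\alpha_2^{p^{a_2}}=\beta_1^{p^b}=\beta_2^{p^b}=1,\quad \beta_1^{p^{b-1}}=\beta_2^{p^{b-1}},$$ together with the relations $[x,y]=1$ for all $x\in\{\alpha_1,\beta_1\}$ and $y\in\{\alpha_2,\beta_2\}$. Then $B_0(G)=0$.
   Context: Commutators are $[x,y]=x^{-1}y^{-1}xy$. For a finite group $H$, the Bogomolov multiplier of $H$ is $$B_0(H)=\bigcap_{A}\ker\{\mathrm{res}:H^2(H,\mathbb Q/\mathbb Z)\to H^2(A,\mathbb Q/\mathbb Z)\},$$ where $H$ acts trivially on $\mathbb Q/\mathbb Z$ and $A$ runs over all bicyclic subgroups of $H$ (a group is bicyclic if it is cyclic or a direct product of two cyclic groups). Equivalently, $A$ may run over all abelian subgroups of $H$. *)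

(* Defs.v *)
From HB Require Import structures.
From mathcomp Require Import all_boot all_order all_algebra.
From mathcomp Require Import all_fingroup all_solvable.
From mathcomp Require Import boolp classical_sets.

Set Implicit Arguments.
Unset Strict Implicit.
Unset Printing Implicit Defensive.

Import GRing.Theory.
Local Open Scope ring_scope.
Local Open Scope quotient_scope.

Definition rat_int : {pred rat} := fun q => q \is a Num.int.

Fact rat_int_zmod_closed : zmod_closed rat_int.
Proof.
split=> [|x y]; rewrite !unfold_in -/(_ \is a Num.int); first exact: rpred0.
exact: rpredB.
Qed.

HB.instance Definition _ :=
  GRing.isZmodClosed.Build rat rat_int rat_int_zmod_closed.

(* The additive group Q/Z. *)
Definition QmodZ := {ideal_quot rat_int}.
HB.instance Definition _ := GRing.Zmodule.on QmodZ.
HB.instance Definition _ := EqQuotient.on QmodZ.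

(* Inhomogeneous 2-cocycles, for the trivial action on Q/Z. *)
Definition cocycle2 (gT : finGroupType) : {pred {ffun gT * gT -> QmodZ}} :=
  fun f => [forall x, forall y, forall z,
    f (y, z) - f ((x * y)%g, z) + f (x, (y * z)%g) - f (x, y) == 0].

Fact cocycle2_zmod_closed (gT : finGroupType) : zmod_closed (@cocycle2 gT).
Proof.
split; first by do 3!apply/forallP=> ?; rewrite !ffunE !subr0 addr0.
move=> f g /forallP fZ /forallP gZ; apply/forallP=> x; apply/forallP=> y.
apply/forallP=> z; rewrite !ffunE.
have /forallP/(_ y)/forallP/(_ z)/eqP f0 := fZ x.
have /forallP/(_ y)/forallP/(_ z)/eqP g0 := gZ x.
apply/eqP; rewrite -[RHS](subrr 0) -[X in _ = X - _]f0 -[X in _ = _ - X]g0.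
by do 3![rewrite [X in _ = _ + X]opprD [RHS]addrACA; apply: f_equal2; last by rewrite ?opprD].
Qed.

HB.instance Definition _ (gT : finGroupType) :=
  GRing.isZmodClosed.Build {ffun gT * gT -> QmodZ} (@cocycle2 gT)
    (@cocycle2_zmod_closed gT).

Record Z2 (gT : finGroupType) := MkZ2 {
  Z2val :> {ffun gT * gT -> QmodZ};
  _ : Z2val \in @cocycle2 gT
}.

HB.instance Definition _ (gT : finGroupType) := [isSub for @Z2val gT].
HB.instance Definition _ (gT : finGroupType) := [Choice of Z2 gT by <:].
HB.instance Definition _ (gT : finGroupType) :=
  [SubChoice_isSubZmodule of Z2 gT by <:].

Definition coboundary2 (gT : finGroupType) : {pred Z2 gT} :=
  fun f => `[< exists c : {ffun gT -> QmodZ},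
    forall x y, f (x, y) = c y - c (x * y)%g + c x >].

Fact coboundary2_zmod_closed (gT : finGroupType) :
  zmod_closed (@coboundary2 gT).
Proof.
split.
  by apply/asboolP; exists 0 => x y; rewrite !ffunE subr0 addr0.
move=> f g /asboolP[c fE] /asboolP[d gE]; apply/asboolP; exists (c - d) => x y.
rewrite [LHS]/= !ffunE fE gE.
by do 2![rewrite [X in _ + X = _]opprD [LHS]addrACA; apply: f_equal2; last by rewrite ?opprD].
Qed.

HB.instance Definition _ (gT : finGroupType) :=
  GRing.isZmodClosed.Build (Z2 gT) (@coboundary2 gT)
    (@coboundary2_zmod_closed gT).

(* H^2(gT, Q/Z) = Z^2 / B^2. *)
Definition H2 (gT : finGroupType) := {ideal_quot @coboundary2 gT}.
HB.instance Definition _ (gT : finGroupType) := GRing.Zmodule.on (H2 gT).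
HB.instance Definition _ (gT : finGroupType) := EqQuotient.on (H2 gT).

Lemma H2_piB (gT : finGroupType) (f g : Z2 gT) :
  \pi_(H2 gT) (f - g) = \pi_(H2 gT) f - \pi_(H2 gT) g.
Proof.
exact: etrans (Quotient.pi_add _ f (- g))
  (congr1 (Quotient.add _) (Quotient.pi_opp _ g)).
Qed.

Section Restriction.
Variables (gT : finGroupType) (A : {group gT}).

Fact Z2res_subproof (f : Z2 gT) :
  [ffun u : subg_of A * subg_of A => f (sgval u.1, sgval u.2)]
    \in @cocycle2 (subg_of A).
Proof.
apply/forallP=> x; apply/forallP=> y; apply/forallP=> z; rewrite !ffunE /=.
case: f => f /= /forallP/(_ (sgval x))/forallP/(_ (sgval y))/forallP.
by move/(_ (sgval z)).
Qed.

Definition Z2res (f : Z2 gT) : Z2 (subg_of A) := MkZ2 (Z2res_subproof f).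

Definition H2res (c : H2 gT) : H2 (subg_of A) :=
  \pi_(H2 _) (Z2res (generic_quotient.repr c)).

Lemma H2res_pi (f : Z2 gT) : H2res (\pi_(H2 gT) f) = \pi_(H2 _) (Z2res f).
Proof.
apply/eqP; rewrite -Quotient.idealrBE.
have : generic_quotient.repr (\pi_(H2 gT) f) - f \in @coboundary2 gT.
  by rewrite Quotient.idealrBE reprK.
move=> /asboolP[c cE]; apply/asboolP; exists [ffun u => c (sgval u)] => x y.
by have := cE (sgval x) (sgval y); rewrite /= !ffunE /=.
Qed.

Fact H2res_is_zmod_morphism : zmod_morphism H2res.
Proof.
move=> c d; rewrite -[c]reprK -[d]reprK -H2_piB !H2res_pi -H2_piB; congr (\pi_(H2 _) _).
by apply/val_inj/ffunP=> u; rewrite /= !ffunE.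
Qed.

HB.instance Definition _ :=
  GRing.isZmodMorphism.Build (H2 gT) (H2 (subg_of A)) H2res
    H2res_is_zmod_morphism.

End Restriction.

Definition bicyclic (gT : finGroupType) (A : {set gT}) : bool :=
  cyclic A ||
  [exists B : {group gT}, exists C : {group gT},
    [&& cyclic B, cyclic C & (B \x C)%g == A]].

(* B_0(gT); each H2res A is a group morphism, so this is an intersection of
   kernels. *)
Definition bogomolov (gT : finGroupType) : set (H2 gT) :=
  (\bigcap_(A in [set A : {group gT} | bicyclic A])
     [set c | H2res A c = 0])%classic.

Arguments bogomolov : clear implicits.

(* Main.v *)
(* A class in B_0(G) is a central extension E -> G by Q/Z in which lifts of
   commuting elements commute.  It splits because the generators have lifts
   satisfying the defining relations: divisibility of Q/Z gives lifts B_i, X_i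
   with [B_i, X_i] = B_i^q, q = p^r, and X_i^(p^a_i) = 1; the commutation
   relations come for free; and the remaining relations are commutators of lifts
   of commuting elements,
     B_i^(p^b) = [B_i^(p^(b-r)), X_i],
     B_1^(p^(b-1)) B_2^(-p^(b-1)) = [B_1^s B_2^(-s), X_1 X_2], s = p^(b-1-r).
   As isoGrp only quantifies over finite groups, Q/Z is replaced by Z/M, with M
   large enough to contain the values of the cocycle and the roots needed.  The
   lifts then generate a quotient of G that maps onto G, hence a complement. *)
Require Import Defs.
From mathcomp Require Import all_boot all_algebra all_fingroup all_solvable.
From mathcomp Require Import classical_sets.
From HB Require Import structures.
From mathcomp Require Import all_order boolp.

Set Implicit Arguments.
Unset Strict Implicit.
Unset Printing Implicit Defensive.

Import Order.TTheory GRing.Theory Num.Theory.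

(** * Lifting relations along a morphism that reflects commutation *)

Lemma conjgX_of_commgX (gT : finGroupType) (x y : gT) q k :
  ([~ x, y] = x ^+ q -> (x ^+ k) ^ y = x ^+ k * x ^+ (k * q))%g.
Proof.
move=> xy; rewrite -expgD addnC conjXg; have -> : (x ^ y = x ^+ q.+1)%g.
  by rewrite expgS -xy mulKVg.
by rewrite -expgM mulSnr mulnC.
Qed.

Section CommutingLifts.

Local Open Scope group_scope.

Variables (eT gT : finGroupType) (pi : {morphism [set: eT] >-> gT}).

Hypothesis commute_lift : forall x y, commute (pi x) (pi y) -> commute x y.

Let piM x y : pi (x * y) = pi x * pi y.
Proof. by rewrite morphM ?inE. Qed.
Let piX x n : pi (x ^+ n) = pi x ^+ n.
Proof. by rewrite morphX ?inE. Qed.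
Let piV x : pi x^-1 = (pi x)^-1.
Proof. by rewrite morphV ?inE. Qed.
Let piR x y : pi [~ x, y] = [~ pi x, pi y].
Proof. by rewrite morphR ?inE. Qed.

(** A trivial image commutes with every [pi x], so [commute_lift] makes the kernel of [pi]
    central. *)
Lemma ker_conjg w x : pi w = 1 -> w ^ x = w.
Proof.
move=> w1; apply/conjg_fixP/commgP/commute_lift; rewrite w1.
exact/commute_sym/commute1.
Qed.

Lemma conjg_ker w x : pi w = 1 -> x ^ w = x.
Proof.
by move=> w1; apply/conjg_fixP/commgP/commute_lift; rewrite w1; apply/commute1.
Qed.

(** Conjugation by [y] multiplies [x ^+ k] by [x ^+ (k * q)]. This factor dies under [pi], so the
    images of [x ^+ k] and [y] commute; then so do [x ^+ k] and [y], and the factor is already 1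
    upstairs. *)
Lemma lift_metacyclic_order (x y : eT) q k :
  [~ x, y] = x ^+ q -> pi x ^+ (k * q) = 1 -> x ^+ (k * q) = 1.
Proof.
move=> xy pix1.
have xky := conjgX_of_commgX k xy.
have /conjg_fixP fix_y : [~ x ^+ k, y] == 1.
  apply/commgP/commute_lift/commgP/conjg_fixP.
  by rewrite -morphJ ?inE // xky piM !piX pix1 mulg1.
by apply: (mulgI (x ^+ k)); rewrite -xky fix_y mulg1.
Qed.

(** Since [y1] acts only on [x1] and [y2] only on [x2], conjugating [u = x1 ^+ k * x2 ^- k] by
    [y1 * y2] multiplies it by the quotient of the two powers to be compared. That quotient lies in
    the kernel, so [u] commutes with [y1 * y2] and the quotient is 1. *)
Lemma lift_amalgam (x1 y1 x2 y2 : eT) q k :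
    [~ x1, y1] = x1 ^+ q -> [~ x2, y2] = x2 ^+ q ->
    commute x1 x2 -> commute x1 y2 -> commute x2 y1 ->
    pi x1 ^+ (k * q) = pi x2 ^+ (k * q) ->
  x1 ^+ (k * q) = x2 ^+ (k * q).
Proof.
move=> xy1 xy2 x1x2 x1y2 x2y1 eq_pi.
pose u := x1 ^+ k * x2 ^- k.
have uy : u ^ (y1 * y2) = u * (x1 ^+ (k * q) * x2 ^- (k * q)).
  have fix1 n : (x1 ^+ n) ^ y2 = x1 ^+ n.
    by apply/conjg_fixP/commgP/commute_sym/commuteX/commute_sym.
  have fix2 n : (x2 ^+ n) ^ y1 = x2 ^+ n.
    by apply/conjg_fixP/commgP/commute_sym/commuteX/commute_sym.
  rewrite conjMg conjVg !conjgM fix2 (conjgX_of_commgX k xy1) conjMg !fix1.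
  rewrite (conjgX_of_commgX k xy2) invMg /u -!mulgA; congr (_ * _).
  rewrite mulgA; apply: commute_sym.
  apply: commuteM; last exact/commuteV/commute_sym/commuteV/commuteX2.
  exact/commute_sym/commuteV/commuteX2.
have pi_mid : pi (x1 ^+ (k * q) * x2 ^- (k * q)) = 1.
  by rewrite piM piV !piX eq_pi mulgV.
have /conjg_fixP fix_u : [~ u, y1 * y2] == 1.
  apply/commgP/commute_lift/commgP/conjg_fixP.
  by rewrite -morphJ ?inE // uy piM pi_mid mulg1.
apply/eqP; rewrite eq_mulgV1; apply/eqP/(mulgI u).
by rewrite -uy fix_u mulg1.
Qed.

(** A finite kernel is not divisible, so roots are assumed only for kernel elements of [D]. Starting
    from lifts in [D] keeps both error terms in [D]; the corrected lifts may leave it. *)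
Lemma lift_metacyclic (D : {group eT}) b a q m :
    {in D, forall z, pi z = 1 -> exists2 w, pi w = 1 & w ^+ q = z} ->
    {in D, forall z, pi z = 1 -> exists2 w, pi w = 1 & w ^+ m = z} ->
    pi @* D = [set: gT] -> [~ b, a] = b ^+ q -> a ^+ m = 1 ->
  exists x y, [/\ pi x = b, pi y = a, [~ x, y] = x ^+ q & y ^+ m = 1].
Proof.
move=> rootq rootm piD ba am.
have lift g : exists2 x, x \in D & pi x = g.
  have : g \in pi @* D by rewrite piD inE.
  by case/morphimP=> x _ Dx ->; exists x.
have [x0 Dx0 x0b] := lift b; have [y0 Dy0 y0a] := lift a.
(* Dividing [y0] by the central [w] will kill its [m]-th power. *)
have [||w w1 wm] := rootm (y0 ^+ m); rewrite ?groupX //.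
  by rewrite piX y0a.
(* Central factors leave [[~ x0, y0]] unchanged, while [v] multiplies [x0 ^+ q] by exactly the
   missing factor [v ^+ q]. *)
have [||v v1 vq] := rootq (x0 ^- q * [~ x0, y0]).
- by rewrite groupM ?groupV ?groupX ?groupR.
- by rewrite piM piV piX piR x0b y0a ba mulVg.
exists (x0 * v), (y0 * w^-1).
have V1 : pi w^-1 = 1 by rewrite piV w1 invg1.
have comv : commute x0 v by apply: commute_lift; rewrite v1; apply: commute1.
have comw : commute y0 w^-1.
  by apply: commute_lift; rewrite V1; apply: commute1.
rewrite !piM x0b y0a v1 V1 !mulg1; split=> //.
  rewrite expgMn // vq mulKVg commgEl conjMg (ker_conjg _ v1) invMg conjgM.
  by rewrite (conjg_ker _ V1) -[RHS](conjg_ker _ v1) commgEl /conjg !mulgA.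
by rewrite expgMn // expVgn wm mulgV.
Qed.

Lemma morphim_join_cycles x1 x2 x3 x4 :
  pi @* (<[x1]> <*> <[x2]> <*> <[x3]> <*> <[x4]>)
    = <[pi x1]> <*> <[pi x2]> <*> <[pi x3]> <*> <[pi x4]>.
Proof. by rewrite !morphimY ?finset.subsetT // !morphim_cycle ?inE. Qed.

End CommutingLifts.

(** * The central extension defined by a 2-cocycle with finite coefficients *)

Definition is_cocycle (Z : zmodType) (gT : finGroupType) (h : gT -> gT -> Z) :=
  forall x y z, (h y z + h x (y * z)%g = h (x * y)%g z + h x y)%R.

Section CentralExtension.

Local Open Scope ring_scope.

Variables (Z : finZmodType) (gT : finGroupType) (h : gT -> gT -> Z).

(* The cocycle identity is a parameter of the type so that the group structure
   can be inferred from it. *)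
Definition cext of is_cocycle h : Type := (Z * gT)%type.

Variable hZ : is_cocycle h.
Local Notation E := (cext hZ).

HB.instance Definition _ := Finite.on E.

Definition cext_mul (u v : E) : E := (u.1 + v.1 + h u.2 v.2, (u.2 * v.2)%g).
Definition cext_one : E := (- h 1%g 1%g, 1%g).
Definition cext_inv (u : E) : E :=
  (- u.1 - h u.2^-1%g u.2 - h 1%g 1%g, u.2^-1%g).

Lemma cocycle1l x : h 1%g x = h 1%g 1%g.
Proof. by have := hZ 1%g 1%g x; rewrite !mul1g => /addrI. Qed.

Fact cext_mulA : associative cext_mul.
Proof.
move=> [a x] [b y] [c z]; rewrite /cext_mul /= mulgA; congr pair.
by rewrite !addrA -[LHS]addrA hZ [RHS](ACl (1*2*4*(5*3))).
Qed.

Fact cext_mul1 : left_id cext_one cext_mul.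
Proof.
by move=> [a x]; rewrite /cext_mul /= mul1g cocycle1l addrAC addNr add0r.
Qed.

Fact cext_mulV : left_inverse cext_one cext_inv cext_mul.
Proof.
move=> [a x]; rewrite /cext_mul /cext_inv /cext_one /= mulVg; congr pair.
by rewrite [LHS](ACl (1*4*(2*5)*3)) /= !addNr !add0r.
Qed.

HB.instance Definition _ :=
  Finite_isGroup.Build E cext_mulA cext_mul1 cext_mulV.

Definition cext_proj (u : E) : gT := u.2.

Fact cext_projM : {in [set: E] &, {morph cext_proj : x y / (x * y)%g}}.
Proof. by []. Qed.
Canonical cext_proj_morphism := Morphism cext_projM.

(* As h is not assumed normalised, the identity of E is (- h 1 1, 1). *)
Definition cext_inj (z : Z) : E := (z - h 1%g 1%g, 1%g).

Lemma cext_injX z n : (cext_inj z ^+ n)%g = cext_inj (z *+ n).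
Proof.
elim: n => [|n IHn]; first by rewrite /cext_inj mulr0n add0r.
rewrite expgS IHn; congr pair; last exact: mul1g.
by rewrite /= mulrS addrA addrNK addrAC.
Qed.

Lemma cext_injK (u : E) : cext_proj u = 1%g -> u = cext_inj (u.1 + h 1%g 1%g).
Proof. by case: u => a x /= ->; rewrite /cext_inj addrK. Qed.

Lemma cext_commute (u v : E) :
    (forall x y, commute x y -> h x y = h y x) ->
  commute (cext_proj u) (cext_proj v) -> commute u v.
Proof.
case: u v => [a x] [b y] hsym /= cxy; congr pair => //.
by rewrite /= (hsym x y) // [a + b]addrC.
Qed.

Section Torsion.

Variable N : nat.
Hypothesis hN : forall x y, h x y *+ N = 0.

(** This serves as [D] in [lift_metacyclic]: it still surjects onto [gT], and its kernel elements
    have roots in [E], though perhaps not in the subgroup itself. *)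
Definition cext_torsion : {set E} := [set u : E | u.1 *+ N == 0].

Fact cext_torsion_group : group_set cext_torsion.
Proof.
apply/group_setP; split=> [|u v]; first by rewrite inE mulNrn hN oppr0.
by rewrite !inE !mulrnDl hN => /eqP-> /eqP->; rewrite !addr0.
Qed.
Canonical cext_torsion_Group := Group cext_torsion_group.

Lemma cext_proj_torsion : (cext_proj @* cext_torsion = [set: gT])%g.
Proof.
apply/setP=> x; rewrite inE; apply/morphimP.
by exists (0, x); rewrite ?inE ?mul0rn.
Qed.

Lemma cext_root n :
    (forall z : Z, z *+ N = 0 -> exists w, w *+ n = z) ->
  {in cext_torsion, forall u, cext_proj u = 1%g ->
     exists2 w, cext_proj w = 1%g & (w ^+ n)%g = u}.
Proof.
move=> root u; rewrite inE => /eqP uN u1.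
have [|w wn] := root (u.1 + h 1%g 1%g); first by rewrite mulrnDl uN hN addr0.
by exists (cext_inj w); rewrite // cext_injX wn -cext_injK.
Qed.

End Torsion.

(** By counting, the projection is injective on [H], so its inverse is a multiplicative section [s].
    The first coordinate of [s x * s y = s (x * y)] writes [h] as the coboundary of minus the first
    coordinate of [s]. *)
Lemma coboundary_of_split (H : {group E}) :
    (cext_proj @* H = [set: gT])%g -> (#|H| <= #|gT|)%N ->
  exists c : gT -> Z, forall x y, h x y = c y - c (x * y)%g + c x.
Proof.
move=> projH leH.
have inj : {in H &, injective cext_proj}.
  apply/imset_injP; rewrite eqn_leq leq_imset_card (leq_trans leH) //.
  by rewrite -morphimEsub ?finset.subsetT //= projH cardsT.
have ex x : exists u : E, (u \in H) && (u.2 == x).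
  have : x \in (cext_proj @* H)%g by rewrite projH inE.
  by case/morphimP=> u _ Hu ->; exists u; rewrite Hu eqxx.
pose s x := xchoose (ex x).
have sP x : s x \in H /\ (s x).2 = x by have /andP[? /eqP] := xchooseP (ex x).
have sM x y : (s x * s y)%g = s (x * y)%g.
  apply: inj; rewrite ?groupM ?(sP _).1 //.
  by rewrite cext_projM ?inE // /cext_proj !(sP _).2.
exists (fun x => - (s x).1) => x y.
have /(congr1 fst)/= := sM x y; rewrite (sP x).2 (sP y).2 => <-.
by rewrite opprK !addrA [RHS](ACl (1*3*(2*5)*4)) /= addNr subrr !add0r.
Qed.

End CentralExtension.

(** * The group Q/Z and its finite cyclic subgroups *)

Section RationalCircle.

Local Open Scope ring_scope.
Local Open Scope quotient_scope.

Definition qmodz (a : rat) : QmodZ := \pi_QmodZ a.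

Fact qmodz_is_zmod_morphism : zmod_morphism qmodz.
Proof.
move=> a b.
exact: etrans (Quotient.pi_add _ a (- b))
  (congr1 (Quotient.add _) (Quotient.pi_opp _ b)).
Qed.
HB.instance Definition _ :=
  GRing.isZmodMorphism.Build rat QmodZ qmodz qmodz_is_zmod_morphism.

Lemma qmodz_eq0 a : (qmodz a == 0) = (a \is a Num.int).
Proof.
by rewrite -(raddf0 qmodz) /qmodz -Quotient.idealrBE subr0.
Qed.

Lemma qmodz_surj q : exists a, q = qmodz a.
Proof. by exists (generic_quotient.repr q); rewrite /qmodz reprK. Qed.

Lemma QmodZ_torsion (q : QmodZ) : exists2 n, (0 < n)%N & q *+ n = 0.
Proof.
have [a ->] := qmodz_surj q; exists `|denq a|%N; first by rewrite absz_gt0.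
apply/eqP; rewrite -raddfMn qmodz_eq0 -mulr_natr.
by rewrite -[a in a * _]divq_num_den natr_absz gtr0_norm // divfK ?intr_eq0.
Qed.

Lemma QmodZ_torsion_family (I : finType) (F : I -> QmodZ) :
  exists2 n, (0 < n)%N & forall i, F i *+ n = 0.
Proof.
have [/= n n_gt0 nF] := all_sig2 (fun i => cid2 (QmodZ_torsion (F i))).
exists (\prod_i n i)%N => [|i]; first exact: prodn_gt0.
by rewrite (bigD1 i) //= mulrnA nF mul0rn.
Qed.

Variable m : nat.

(** The identification of the integers modulo [m.+1] with the [m.+1]-torsion of Q/Z; it transports
    cocycles to finite coefficients and coboundaries back. *)
Definition qmodz_ord (i : 'I_m.+1) : QmodZ := qmodz (i%:R / m.+1%:R).

Lemma qmodz_modn k : qmodz ((k %% m.+1)%:R / m.+1%:R) = qmodz (k%:R / m.+1%:R).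
Proof.
apply/eqP; rewrite eq_sym -subr_eq0 -raddfB qmodz_eq0 {1}(divn_eq k m.+1).
by rewrite -mulrBl natrD addrK natrM mulfK ?pnatr_eq0 // natr_int.
Qed.

Fact qmodz_ord_is_nmod_morphism : nmod_morphism qmodz_ord.
Proof.
split=> [|i j]; first by rewrite /qmodz_ord mul0r raddf0.
by rewrite /qmodz_ord /= qmodz_modn -raddfD -mulrDl natrD.
Qed.

HB.instance Definition _ :=
  GRing.isNmodMorphism.Build 'I_m.+1 QmodZ qmodz_ord qmodz_ord_is_nmod_morphism.

Lemma qmodz_ord_inj : injective qmodz_ord.
Proof.
apply: raddf_inj => i /eqP; rewrite qmodz_eq0 => int_i; apply/val_inj/eqP => /=.
have m0 : 0 < m.+1%:R :> rat by rewrite ltr0n.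
have /natrP[k ik] : (i%:R / m.+1%:R : rat) \is a Num.nat.
  by rewrite natrEint int_i divr_ge0 ?ler0n.
have : k%:R < 1 :> rat by rewrite -ik ltr_pdivrMr // mul1r ltr_nat.
rewrite ltrn1 ltnS leqn0 => /eqP k0; move/eqP: ik.
by rewrite k0 mulf_eq0 invr_eq0 (gt_eqF m0) orbF pnatr_eq0.
Qed.

Lemma qmodz_ord_torsion (q : QmodZ) : q *+ m.+1 = 0 -> exists i, qmodz_ord i = q.
Proof.
have [a ->] := qmodz_surj q; move/eqP; rewrite -raddfMn qmodz_eq0 => /intrP[z az].
have m0 : m.+1%:R != 0 :> rat by rewrite pnatr_eq0.
have [k zk] : exists k : nat, (z %% m.+1)%Z = k.
  by exists `|(z %% m.+1)%Z|%N; rewrite gez0_abs ?modz_ge0.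
exists (inord k); rewrite /qmodz_ord inordK; last first.
  by rewrite -ltz_nat -zk ltz_pmod.
apply/eqP; rewrite eq_sym -subr_eq0 -raddfB qmodz_eq0.
have -> : a = z%:~R / m.+1%:R by rewrite -az -[a *+ _]mulr_natr mulfK.
rewrite {1}(divz_eq z m.+1) zk.
by rewrite -mulrBl intrD addrK intrM mulfK // intr_int.
Qed.

(** From [z *+ N = 0], [m.+1] divides [z * N], hence so does [n * N]; cancelling [N], the
    representative of [z] is a multiple [t * n], and [t] gives the root. *)
Lemma ord_divisible N n (z : 'I_m.+1) :
  (0 < N)%N -> (n * N %| m.+1)%N -> z *+ N = 0 -> exists w : 'I_m.+1, w *+ n = z.
Proof.
move=> N_gt0 nN /(congr1 val); rewrite Zp_mulrn /= => /eqP.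
rewrite -/(dvdn _ _) => /(dvdn_trans nN); rewrite dvdn_pmul2r // => /dvdnP[t zt].
exists (inZp t); rewrite Zp_mulrn; apply/val_inj.
by rewrite /= modnMml -zt modn_small.
Qed.

End RationalCircle.

(** * Reduction of the vanishing of B_0 to finite coefficients *)

Section Bogomolov.

Local Open Scope group_scope.

(** The number of cyclic factors in the structure theorem is the minimal number of generators, here
    at most 2. *)
Lemma abelian_gen2_bicyclic (gT : finGroupType) (x y : gT) :
  commute x y -> bicyclic <<[set x; y]>>.
Proof.
move=> cxy; have cA : abelian <<[set x; y]>>.
  rewrite abelian_gen; apply/centsP=> u + v.
  by rewrite !inE => /orP[]/eqP-> /orP[]/eqP->.
have [s defA sA] := abelian_structure cA.
have le2 : (size s <= 2)%N.
  rewrite -(size_map order) sA size_abelian_type // -grank_abelian //.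
  by rewrite (leq_trans (grank_min _)) // cards2; case: (x != y).
rewrite /bicyclic; case: s defA le2 {sA} => [|a [|b []]] //.
- by rewrite big_nil => <- _; rewrite cyclic1.
- by rewrite big_seq1 => <- _; rewrite cycle_cyclic.
rewrite big_cons big_seq1 => <- _; apply/orP; right.
apply/existsP; exists <[a]>%G; apply/existsP; exists <[b]>%G.
by rewrite !cycle_cyclic eqxx.
Qed.

Local Open Scope ring_scope.
Local Open Scope quotient_scope.

Lemma Z2_is_cocycle (gT : finGroupType) (f : Z2 gT) :
  is_cocycle (fun x y => f (x, y)).
Proof.
case: f => f fZ x y z /=.
move/forallP/(_ x)/forallP/(_ y)/forallP/(_ z): fZ.
by rewrite [X in X - _]addrAC -[X in X == 0]addrA -opprD subr_eq0 => /eqP.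
Qed.

Lemma H2_eq0 (gT : finGroupType) (f : Z2 gT) :
  (\pi_(H2 gT) f == 0) = (f \in @coboundary2 gT).
Proof.
have -> : (0 : H2 gT) = \pi_(H2 gT) 0.
  by rewrite -[X in \pi_(H2 gT) X](subrr f) H2_piB subrr.
by rewrite -Quotient.idealrBE subr0.
Qed.

(** On the bicyclic group generated by [x] and [y] the cocycle is a coboundary, and
    [c y - c (x * y) + c x] is symmetric when [x] and [y] commute. *)
Lemma bogomolov_commute (gT : finGroupType) (f : Z2 gT) (x y : gT) :
  bogomolov gT (\pi_(H2 gT) f) -> commute x y -> f (x, y) = f (y, x).
Proof.
move=> /(_ <<[set x; y]>>%G) fB cxy.
have /eqP : H2res <<[set x; y]>>%G (\pi_(H2 gT) f) = 0.
  exact: fB (abelian_gen2_bicyclic cxy).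
rewrite H2res_pi H2_eq0 => /asboolP[c cE].
have Ax : x \in <<[set x; y]>> by rewrite mem_gen ?inE ?eqxx.
have Ay : y \in <<[set x; y]>> by rewrite mem_gen ?inE ?eqxx ?orbT.
have := cE (subg _ x) (subg _ y); have := cE (subg _ y) (subg _ x).
rewrite !ffunE /= !subgK // => -> ->.
by rewrite -!morphM //= cxy [LHS]addrC [LHS]addrCA [LHS]addrC.
Qed.

Lemma bogomolov_eq0 (gT : finGroupType) (n : nat) :
  (0 < n)%N ->
  (forall (Z : finZmodType) (h : gT -> gT -> Z) (N : nat),
     is_cocycle h -> (forall x y, commute x y -> h x y = h y x) ->
     (forall x y, h x y *+ N = 0) ->
     (forall d (z : Z), (d %| n)%N -> z *+ N = 0 -> exists w, w *+ d = z) ->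
     exists c : gT -> Z, forall x y, h x y = c y - c (x * y)%g + c x) ->
  bogomolov gT = [set 0]%classic.
Proof.
move=> n_gt0 split_h; apply/seteqP; split=> [c|_ ->] /=; last first.
  by move=> A _; rewrite /= raddf0.
rewrite -[c]reprK; set f := generic_quotient.repr c => fB.
have [N N_gt0 fN] := QmodZ_torsion_family f.
(* The order [n * N] leaves room both for the values of [f], killed by [N], and for [d]-th roots of
   [N]-torsion elements when [d] divides [n]. The predecessor is taken because the coefficients are
   ['I_M.+1]. *)
pose M := (n * N).-1.
have ME : M.+1 = (n * N)%N by rewrite prednK // muln_gt0 n_gt0.
have fM u : exists i : 'I_M.+1, qmodz_ord i = f u.
  by apply: qmodz_ord_torsion; rewrite ME mulnC mulrnA fN mul0rn.
have [h hE] := choice fM.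
have [||||c' cE] := split_h 'I_M.+1 (fun x y => h (x, y)) N.
- move=> x y z; apply: (@qmodz_ord_inj M); rewrite !raddfD /= !hE.
  exact: Z2_is_cocycle.
- move=> x y cxy; apply: (@qmodz_ord_inj M); rewrite !hE.
  exact: bogomolov_commute.
- by move=> x y; apply: (@qmodz_ord_inj M); rewrite raddfMn /= hE fN raddf0.
- by move=> d z dn; apply: ord_divisible; rewrite // ME dvdn_pmul2r.
apply/eqP; rewrite H2_eq0; apply/asboolP.
exists [ffun x => qmodz_ord (c' x)] => x y.
by rewrite !ffunE -hE cE raddfD raddfB.
Qed.

End Bogomolov.

(** * Lifting the presentation and splitting the extension *)

Lemma lift_presentation (p a1 a2 r b : nat) (eT gT : finGroupType)
    (pi : {morphism [set: eT] >-> gT}) (D : {group eT}) :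
    r <= b - 1 ->
    (forall x y, commute (pi x) (pi y) -> commute x y) ->
    (forall k, k <= r + a1 + a2 -> {in D, forall z, pi z = 1%g ->
       exists2 w, pi w = 1%g & (w ^+ (p ^ k))%g = z}) ->
    (pi @* D = [set: gT])%g ->
    ([set: gT] \isog Grp (beta1 : beta2 : alpha1 : alpha2 :
       ([~ beta1, alpha1] = beta1 ^+ (p ^ r),
        [~ beta2, alpha2] = beta2 ^+ (p ^ r),
        alpha1 ^+ (p ^ a1) = 1, alpha2 ^+ (p ^ a2) = 1,
        beta1 ^+ (p ^ b) = 1, beta2 ^+ (p ^ b) = 1,
        beta1 ^+ (p ^ (b - 1)) = beta2 ^+ (p ^ (b - 1)),
        [~ alpha1, alpha2] = 1, [~ alpha1, beta2] = 1,
        [~ beta1, alpha2] = 1, [~ beta1, beta2] = 1)))%g ->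
  exists2 H : {group eT}, (pi @* H = [set: gT])%g & #|H| <= #|gT|.
Proof.
move=> r_le CP rootD piD presG.
(* The presentation yields generators of [gT] itself that satisfy the relations. *)
have /existsP[[[[g1 g2] h1] h2]] := isoGrp_hom presG.
move=> /eqP[genG r1 r2 r3 r4 r5 r6 r7 c1 c2 c3 c4].
have [||B1 [X1 [B1E X1E BX1 X1m]]] :=
  lift_metacyclic CP (rootD r _) (rootD a1 _) piD r1 r3.
- by rewrite -addnA leq_addr.
- by rewrite addnAC leq_addl.
have [||B2 [X2 [B2E X2E BX2 X2m]]] :=
  lift_metacyclic CP (rootD r _) (rootD a2 _) piD r2 r4.
- by rewrite -addnA leq_addr.
- by rewrite leq_addl.
have cX : commute X1 X2 by apply: CP; rewrite X1E X2E; apply/commgP/eqP.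
have cXB : commute X1 B2 by apply: CP; rewrite X1E B2E; apply/commgP/eqP.
have cBX : commute B1 X2 by apply: CP; rewrite B1E X2E; apply/commgP/eqP.
have cB : commute B1 B2 by apply: CP; rewrite B1E B2E; apply/commgP/eqP.
have le_rb : r <= b by rewrite (leq_trans r_le) ?leq_subr.
(* These factorisations give the shape [k * q] with [q = p ^ r]; the second needs [r <= b - 1]. *)
have pbE : p ^ b = p ^ (b - r) * p ^ r by rewrite -expnD subnK.
have pb1E : p ^ (b - 1) = p ^ (b - 1 - r) * p ^ r by rewrite -expnD subnK.
have B1b : (B1 ^+ (p ^ b) = 1)%g.
  by rewrite pbE; apply: (lift_metacyclic_order CP BX1); rewrite B1E -pbE.
have B2b : (B2 ^+ (p ^ b) = 1)%g.
  by rewrite pbE; apply: (lift_metacyclic_order CP BX2); rewrite B2E -pbE.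
have B12 : (B1 ^+ (p ^ (b - 1)) = B2 ^+ (p ^ (b - 1)))%g.
  rewrite pb1E; apply: (lift_amalgam CP BX1 BX2 cB cBX).
    exact/commute_sym.
  by rewrite B1E B2E -pb1E.
pose H := (<[B1]> <*> <[B2]> <*> <[X1]> <*> <[X2]>)%G.
have piH : (pi @* H)%g = [set: gT].
  by rewrite morphim_join_cycles B1E B2E X1E X2E.
(* The lifts satisfy every defining relation, so the universal property makes [H] a quotient of
   [gT], which bounds its order. *)
have homH : (H \homg [set: gT])%g.
  rewrite presG; apply/existsP; exists (B1, B2, X1, X2) => /=.
  move: cX cXB cBX cB => /commgP/eqP-> /commgP/eqP-> /commgP/eqP-> /commgP/eqP->.
  by rewrite BX1 BX2 X1m X2m B1b B2b B12.
by exists H; rewrite // -[in X in _ <= X]cardsT leq_homg.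
Qed.

Theorem corollary3p3 (p a1 a2 r b : nat) (p_prime : prime p)
    (a1_gt0 : 0 < a1) (a2_gt0 : 0 < a2)
    (r_ge1 : 1 <= r) (r_le : r <= b - 1) (b_ge2 : 2 <= b)
    (gT : finGroupType)
    (presG : ([set: gT] \isog Grp (beta1 : beta2 : alpha1 : alpha2 :
       ([~ beta1, alpha1] = beta1 ^+ (p ^ r),
        [~ beta2, alpha2] = beta2 ^+ (p ^ r),
        alpha1 ^+ (p ^ a1) = 1, alpha2 ^+ (p ^ a2) = 1,
        beta1 ^+ (p ^ b) = 1, beta2 ^+ (p ^ b) = 1,
        beta1 ^+ (p ^ (b - 1)) = beta2 ^+ (p ^ (b - 1)),
        [~ alpha1, alpha2] = 1, [~ alpha1, beta2] = 1,
        [~ beta1, alpha2] = 1, [~ beta1, beta2] = 1)))%g) :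
  bogomolov gT = [set 0%R]%classic.
Proof.
have p_gt0 := prime_gt0 p_prime.
(* The roots extracted in the lifting have degrees [p ^ r], [p ^ a1] and [p ^ a2], all dividing this
   power of [p]. *)
apply: (@bogomolov_eq0 gT (p ^ (r + a1 + a2))) => [|Z h N hZ hsym hN root].
  by rewrite expn_gt0 p_gt0.
have [|k le_k||H projH leH] := lift_presentation r_le _ _ _ presG
  (pi := cext_proj_morphism hZ) (D := cext_torsion_Group hZ hN).
- by move=> u v; apply: cext_commute.
- by apply: cext_root => // z; apply: root; apply: dvdn_exp2l.
- exact: cext_proj_torsion.
exact: coboundary_of_split projH leH.
Qed.
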